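(* Let $f:\mathcal{X}\to\mathcal{Z}$ and $g:\mathcal{Y}\to\mathcal{Z}$ be sample-smooth, and give each fibre $f^{-1}(z)$, $g^{-1}(z)$ its subspace structure. Put $$\mathcal{SSS}_{\mathcal{Z}}(f,g):=\bigsqcup_{z\in\mathcal{Z}}\mathbf{SSS}\bigl(f^{-1}(z),\,g^{-1}(z)\bigr),$$ with $\varpi:\mathcal{SSS}_{\mathcal{Z}}(f,g)\to\mathcal{Z}$ sending the summand at $z$ to $z$, and let $\mathcal{SSS}_{\mathcal{Z}}(f,g)^{\Omega_n}$ be the set of all maps $F:\Omega_n\to\mathcal{SSS}_{\mathcal{Z}}(f,g)$ such that $\varpi\circ F\in\mathcal{Z}^{\Omega_n}$ and, for all $m\ge0$, all $h\in\mathbb{S}(\Omega_m,\Omega_n)$ and all $q\in\mathcal{X}^{\Omega_m}$ with $f\circ q=\varpi\circ F\circ h$, one has $$\bigl(u\mapsto F(h(u))(q(u))\bigr)\in\mathcal{Y}^{\Omega_m}.$$ Then $\mathcal{SSS}_{\mathcal{Z}}(f,g)$ (with the map $\varpi$ to $\mathcal{Z}$) is the exponential $g^f$ in the slice category $\mathbf{SSS}_{/\mathcal{Z}}$. In particular $\mathbf{SSS}$ is locally cartesian closed.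
   Context: **Sample space.** $\Omega=[0,1]^{\mathbb{N}}$; $\mathcal{B}_\Omega$ is the universal completion of its Borel (product) $\sigma$-algebra, i.e. all universally measurable subsets; $\Omega^\Omega$ is the set of all $\mathcal{B}_\Omega$-$\mathcal{B}_\Omega$-measurable self-maps of $\Omega$. **Site.** $\Omega_n:=\mathbb{R}^n\times\Omega$, $n\ge0$. A map $g:\Omega_m\to\mathbb{R}^n$ is mixed-smooth, $g\in\mathcal{C}^\infty_{\mathrm{mix}}(\Omega_m,\mathbb{R}^n)$, if (M1) $g(-,\omega)\in C^\infty(\mathbb{R}^m,\mathbb{R}^n)$ for every $\omega$, and (M2) $g(t,-)$ is $\mathcal{B}_\Omega$-Borel measurable for every $t$. The category $\mathbb{S}$ has objects $\Omega_n$ and morphisms $\mathbb{S}(\Omega_m,\Omega_n)=\{(g,\Phi): g\in\mathcal{C}^\infty_{\mathrm{mix}}(\Omega_m,\mathbb{R}^n),\Phi\in\Omega^\Omega\}$, where $(g,\Phi)(t,\omega)=(g(t,\omega),\Phi(\omega))$, composed as maps. **Sample-smooth spaces.** A sample-smooth space is a set $\mathcal{X}$ with, for each $n\ge0$, a set $\mathcal{X}^{\Omega_n}$ of maps $\Omega_n\to\mathcal{X}$ (plots) containing all constant maps and such that $p\in\mathcal{X}^{\Omega_n}$, $h\in\mathbb{S}(\Omega_m,\Omega_n)$ imply $p\circ h\in\mathcal{X}^{\Omega_m}$. A map $f:\mathcal{X}\to\mathcal{Y}$ is sample-smooth (a morphism of $\mathbf{SSS}$) if $f\circ p\in\mathcal{Y}^{\Omega_n}$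 for all $n$ and $p\in\mathcal{X}^{\Omega_n}$. A subset carries as subspace structure the plots of the ambient space with values in it. Fibre products are the set-theoretic ones with plots the pairs of plots agreeing over the base. *)

(* Defs.v *)
From HB Require Import structures.
From mathcomp Require Import all_boot all_order all_algebra.
From mathcomp Require Import all_classical all_reals all_analysis.
From mathcomp Require Import measurable_realfun.

Set Implicit Arguments.
Unset Strict Implicit.
Unset Printing Implicit Defensive.

Import Order.TTheory GRing.Theory Num.Theory.
Import numFieldNormedType.Exports.

Local Open Scope classical_set_scope.
Local Open Scope ring_scope.

(** * The sample space *)

Definition Omega (R : realType) : Type := nat -> {x : R | 0 <= x <= 1}.

Fact zero_in_unit_interval (R : realType) : 0 <= (0 : R) <= 1.
Proof. by rewrite lexx ler01. Qed.

HB.instance Definition _ (R : realType) := gen_eqMixin (Omega R).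
HB.instance Definition _ (R : realType) := gen_choiceMixin (Omega R).
HB.instance Definition _ (R : realType) :=
  isPointed.Build (Omega R) (fun=> exist _ 0 (zero_in_unit_interval R)).

Definition cylinders (R : realType) : set (set (Omega R)) :=
  \bigcup_k preimage_set_system setT (fun w : Omega R => sval (w k)) measurable.

(* The product topology has a countable base, so its Borel sigma-algebra is
   the product sigma-algebra generated by the cylinders. *)
Definition borel_Omega (R : realType) := g_sigma_algebraType (@cylinders R).

(* Completing with respect to all finite or sigma-finite measures gives the same
   sets, since a nonzero one has the null sets of some probability. *)
Definition universally_measurable (R : realType) : set (set (Omega R)) :=
  [set A | forall P : probability (borel_Omega R) R, completed_algebra_gen P A].

Section universally_measurable_sigma_algebra.
Variable R : realType.

Lemma universally_measurable0 : @universally_measurable R set0.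
Proof.
move=> P; exists set0 => //; exists set0; last by rewrite setU0.
exact: negligible_set0.
Qed.

Lemma universally_measurableC (A : set (Omega R)) :
  universally_measurable A -> universally_measurable (~` A).
Proof.
move=> mA P; have [B mB [N [M [mM M0 NM]] BNA]] := mA P.
exists (~` B `\` M); first by apply: measurableD => //; exact: measurableC.
exists (~` A `&` M); first by exists M; split => // x [].
rewrite -BNA; apply/seteqP; split => [x [[Bx Mx]|[]//]|x].
  by move=> [//|/NM].
move=> BNx; have [Mx|Mx] := pselect (M x); first by right.
by left; split => // Bx; apply: BNx; left.
Qed.

Lemma universally_measurable_bigcup (F : (set (Omega R))^nat) :
  (forall i, universally_measurable (F i)) ->
  universally_measurable (\bigcup_i F i).
Proof.
move=> mF P.
have /choice[B BP] i : exists B, @measurable _ (borel_Omega R) B /\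
    exists2 N, P.-negligible N & B `|` N = F i.
  by have [B mB [N nN BN]] := mF i P; exists B; split => //; exists N.
have /choice[N NP] i : exists N, P.-negligible N /\ B i `|` N = F i.
  by have [_ [N nN BN]] := BP i; exists N.
exists (\bigcup_i B i).
  by apply: bigcupT_measurable => i; have [] := BP i.
exists (\bigcup_i N i); first by apply: negligible_bigcup => i; have [] := NP i.
by rewrite -bigcupU; apply: eq_bigcup => // i _; have [] := NP i.
Qed.

End universally_measurable_sigma_algebra.

Definition Omega_display : measure_display. Proof. exact. Qed.

HB.instance Definition _ (R : realType) :=
  @isMeasurable.Build Omega_display (Omega R) (@universally_measurable R)
    (@universally_measurable0 R) (@universally_measurableC R)
    (@universally_measurable_bigcup R).

(** * The site *)

Definition Omega_ (R : realType) (n : nat) : Type := ('rV[R]_n * Omega R)%type.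

(* Dimension being finite, the derivative of [f] is C^k as a map into the linear
   maps iff [fun x => 'd f x v] is C^k for each direction [v]. *)
Fixpoint Ck (R : realType) (m n k : nat) (f : 'rV[R]_m -> 'rV[R]_n) : Prop :=
  match k with
  | 0 => continuous f
  | k'.+1 => (forall x, differentiable f x) /\
             (forall v, Ck k' (fun x => 'd f x v))
  end.

Definition smooth (R : realType) (m n : nat) (f : 'rV[R]_m -> 'rV[R]_n) : Prop :=
  forall k, Ck k f.

Definition borel_rV (R : realType) (n : nat) :=
  g_sigma_algebraType (@open 'rV[R]_n).

Definition mixed_smooth (R : realType) (m n : nat)
    (g : Omega_ R m -> 'rV[R]_n) : Prop :=
  (forall w, smooth (fun t => g (t, w))) /\
  (forall t, measurable_fun setT (fun w : Omega R => g (t, w) : borel_rV R n)).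

Definition site_hom (R : realType) (m n : nat)
    (h : Omega_ R m -> Omega_ R n) : Prop :=
  exists (g : Omega_ R m -> 'rV[R]_n) (Phi : Omega R -> Omega R),
    [/\ mixed_smooth g, measurable_fun setT Phi &
        forall t w, h (t, w) = (g (t, w), Phi w)].

(** * Sample-smooth spaces *)

Definition plot_family (R : realType) (X : Type) : Type :=
  forall n, set (Omega_ R n -> X).

Record sss_axioms (R : realType) (X : Type) (P : plot_family R X) : Prop := {
  plot_cst : forall n (x : X), P n (fun=> x);
  plot_comp : forall m n (p : Omega_ R n -> X) (h : Omega_ R m -> Omega_ R n),
    P n p -> site_hom h -> P m (p \o h) }.

Record SSS (R : realType) := MkSSS {
  sss_carrier :> Type;
  plot : plot_family R sss_carrier;
  plotP : sss_axioms plot }.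

Arguments MkSSS {R sss_carrier plot} plotP.
Arguments plot {R} s n _.

Definition sample_smooth (R : realType) (X Y : SSS R) (f : X -> Y) : Prop :=
  forall n (p : Omega_ R n -> X), plot X n p -> plot Y n (f \o p).

Record sss_hom (R : realType) (X Y : SSS R) := MkHom {
  hom_fun :> X -> Y;
  hom_smooth : sample_smooth hom_fun }.

Lemma sss_hom_eq (R : realType) (X Y : SSS R) (f g : sss_hom X Y) :
  f =1 g -> f = g.
Proof.
by case: f g => [f sf] [g sg] /= /funext fg; subst g; congr MkHom.
Qed.

Definition sss_id (R : realType) (X : SSS R) : sss_hom X X :=
  @MkHom R X X (fun x => x) (fun n p hp => hp).

Definition sss_comp (R : realType) (X Y Z : SSS R)
    (g : sss_hom Y Z) (f : sss_hom X Y) : sss_hom X Z :=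
  @MkHom R X Z (g \o f)
    (fun n p hp => hom_smooth g (hom_smooth f hp)).

Section subset_space.
Variables (R : realType) (X : SSS R) (A : set X).

Definition subset_plot : plot_family R {x : X | A x} :=
  fun n => [set p | plot X n (fun u => sval (p u))].

Fact subset_plotP : sss_axioms subset_plot.
Proof.
split=> [n x|m n p h /= pp hh]; first exact: (plot_cst (plotP X)).
exact: (plot_comp (plotP X) pp hh).
Qed.

Definition subset_space : SSS R := MkSSS subset_plotP.

End subset_space.

Definition fibre (R : realType) (X Z : SSS R) (f : sss_hom X Z) (z : Z) : SSS R :=
  subset_space [set x : X | f x = z].

Section fibre_product.
Variables (R : realType) (X Y Z : SSS R) (f : sss_hom X Z) (g : sss_hom Y Z).

Definition fibre_product_plot :
    plot_family R {w : X * Y | f w.1 = g w.2} :=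
  fun n => [set p | plot X n (fun u => (sval (p u)).1) /\
                    plot Y n (fun u => (sval (p u)).2)].

Fact fibre_product_plotP : sss_axioms fibre_product_plot.
Proof.
split=> [n w|m n p h /= [pX pY] hh].
  by split; [exact: (plot_cst (plotP X))|exact: (plot_cst (plotP Y))].
by split; [exact: (plot_comp (plotP X) pX hh)|exact: (plot_comp (plotP Y) pY hh)].
Qed.

Definition fibre_product : SSS R := MkSSS fibre_product_plotP.

Definition fibre_fst : sss_hom fibre_product X :=
  @MkHom R fibre_product X (fun w => (sval w).1) (fun n p pp => pp.1).

Definition fibre_snd : sss_hom fibre_product Y :=
  @MkHom R fibre_product Y (fun w => (sval w).2) (fun n p pp => pp.2).

End fibre_product.

(** * The space of maps between fibres *)

Section fibrewise_maps.
Variables (R : realType) (X Y Z : SSS R) (f : sss_hom X Z) (g : sss_hom Y Z).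

Definition fibrewise_map : Type := {z : Z & sss_hom (fibre f z) (fibre g z)}.

Definition varpi (F : fibrewise_map) : Z := projT1 F.

Definition fibrewise_apply (F : fibrewise_map) (x : X) (e : f x = varpi F) : Y :=
  sval (projT2 F (exist _ x e)).

Definition fibrewise_plot : plot_family R fibrewise_map :=
  fun n => [set F |
    plot Z n (varpi \o F) /\
    forall m (h : Omega_ R m -> Omega_ R n), site_hom h ->
    forall q : Omega_ R m -> X, plot X m q ->
    forall e : (forall u, f (q u) = varpi (F (h u))),
      plot Y m (fun u => fibrewise_apply (e u))].

End fibrewise_maps.

Arguments varpi {R X Y Z} f g F.
Arguments fibrewise_plot {R X Y Z} f g n _.

(** * Categories *)

Record category := Category {
  obj :> Type;
  mor : obj -> obj -> Type;
  mor_id : forall A, mor A A;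
  mor_comp : forall A B C, mor B C -> mor A B -> mor A C;
  mor_comp1m : forall A B (u : mor A B), mor_comp (mor_id B) u = u;
  mor_compm1 : forall A B (u : mor A B), mor_comp u (mor_id A) = u;
  mor_compA : forall A B C D (u : mor C D) (v : mor B C) (w : mor A B),
    mor_comp u (mor_comp v w) = mor_comp (mor_comp u v) w }.

Arguments mor {c} _ _.
Arguments mor_id {c} A.
Arguments mor_comp {c A B C} _ _.

Definition is_terminal (C : category) (T : C) : Prop :=
  forall W : C, exists! u : mor W T, True.

Definition is_product (C : category) (A B P : C)
    (p1 : mor P A) (p2 : mor P B) : Prop :=
  forall (W : C) (a : mor W A) (b : mor W B),
    exists! u : mor W P, mor_comp p1 u = a /\ mor_comp p2 u = b.

(* [E], with evaluation [ev] on the product cone [(P, p1, p2)] of [E] and [A],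
   is the exponential [B ^ A]; [u] below is the map [l * id_A] between the
   products. *)
Definition is_exponential (C : category) (A B E P : C)
    (p1 : mor P E) (p2 : mor P A) (ev : mor P B) : Prop :=
  is_product p1 p2 /\
  forall (W Q : C) (q1 : mor Q W) (q2 : mor Q A), is_product q1 q2 ->
  forall k : mor Q B,
    exists! l : mor W E, exists u : mor Q P,
      [/\ mor_comp p1 u = mor_comp l q1, mor_comp p2 u = q2 & mor_comp ev u = k].

Definition has_terminal (C : category) : Prop := exists T : C, is_terminal T.

Definition has_products (C : category) : Prop :=
  forall A B : C, exists (P : C) (p1 : mor P A) (p2 : mor P B), is_product p1 p2.

Definition has_exponentials (C : category) : Prop :=
  forall A B : C, exists (E P : C) (p1 : mor P E) (p2 : mor P A) (ev : mor P B),
    is_exponential p1 p2 ev.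

Definition cartesian_closed (C : category) : Prop :=
  [/\ has_terminal C, has_products C & has_exponentials C].

Section slice.
Variables (C : category) (Z : C).

Record slice_obj := SliceObj { slice_dom : C; slice_arr : mor slice_dom Z }.

Definition slice_hom (A B : slice_obj) : Type :=
  {u : mor (slice_dom A) (slice_dom B) | mor_comp (slice_arr B) u = slice_arr A}.

Definition slice_id (A : slice_obj) : slice_hom A A :=
  exist _ (mor_id (slice_dom A)) (mor_compm1 (slice_arr A)).

Fact slice_comp_subproof (A B D : slice_obj)
    (u : slice_hom B D) (v : slice_hom A B) :
  mor_comp (slice_arr D) (mor_comp (sval u) (sval v)) = slice_arr A.
Proof. by rewrite mor_compA (svalP u) (svalP v). Qed.

Definition slice_comp (A B D : slice_obj)
    (u : slice_hom B D) (v : slice_hom A B) : slice_hom A D :=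
  exist _ (mor_comp (sval u) (sval v)) (slice_comp_subproof u v).

Fact slice_hom_eq (A B : slice_obj) (u v : slice_hom A B) :
  sval u = sval v -> u = v.
Proof. by case: u v => [u eu] [v ev] /= uv; subst v; congr exist. Qed.

Fact slice_comp1m A B (u : slice_hom A B) : slice_comp (slice_id B) u = u.
Proof. by apply: slice_hom_eq; exact: mor_comp1m. Qed.

Fact slice_compm1 A B (u : slice_hom A B) : slice_comp u (slice_id A) = u.
Proof. by apply: slice_hom_eq; exact: mor_compm1. Qed.

Fact slice_compA A B D E
    (u : slice_hom D E) (v : slice_hom B D) (w : slice_hom A B) :
  slice_comp u (slice_comp v w) = slice_comp (slice_comp u v) w.
Proof. by apply: slice_hom_eq; exact: mor_compA. Qed.

Definition slice : category :=
  Category slice_comp1m slice_compm1 slice_compA.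

End slice.

(* The slice over [Z] always has a terminal object and its products are the
   pullbacks over [Z], so with the terminal object of [C] this includes the
   existence of all finite limits in [C]. *)
Definition locally_cartesian_closed (C : category) : Prop :=
  has_terminal C /\ forall Z : C, cartesian_closed (slice Z).

Section sss_category.
Variable R : realType.

Fact sss_comp1m (X Y : SSS R) (f : sss_hom X Y) : sss_comp (sss_id Y) f = f.
Proof. exact: sss_hom_eq. Qed.

Fact sss_compm1 (X Y : SSS R) (f : sss_hom X Y) : sss_comp f (sss_id X) = f.
Proof. exact: sss_hom_eq. Qed.

Fact sss_compA (X Y Z W : SSS R)
    (f : sss_hom Z W) (g : sss_hom Y Z) (h : sss_hom X Y) :
  sss_comp f (sss_comp g h) = sss_comp (sss_comp f g) h.
Proof. exact: sss_hom_eq. Qed.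

Definition SSS_cat : category := Category sss_comp1m sss_compm1 sss_compA.

Definition sss_over (X Z : SSS R) (f : sss_hom X Z) : slice (Z : SSS_cat) :=
  @SliceObj SSS_cat Z X f.

Section fibre_product_over.
Variables (X Y Z : SSS R) (f : sss_hom X Z) (g : sss_hom Y Z).

Definition fibre_product_over : slice (Z : SSS_cat) :=
  sss_over (sss_comp f (fibre_fst f g)).

Definition fibre_fst_over : mor fibre_product_over (sss_over f) :=
  exist _ (fibre_fst f g : @mor SSS_cat _ _) erefl.

Fact fibre_snd_over_subproof :
  sss_comp g (fibre_snd f g) = sss_comp f (fibre_fst f g).
Proof. by apply: sss_hom_eq => -[w /= ->]. Qed.

Definition fibre_snd_over : mor fibre_product_over (sss_over g) :=
  exist _ (fibre_snd f g : @mor SSS_cat _ _) fibre_snd_over_subproof.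

End fibre_product_over.

Definition slice_fun (X Y Z : SSS R) (f : sss_hom X Z) (g : sss_hom Y Z)
    (u : mor (sss_over f) (sss_over g)) : X -> Y :=
  hom_fun (sval u : sss_hom X Y).

End sss_category.

(* Main.v *)
From HB Require Import structures.
Require Import Defs.
From mathcomp Require Import all_boot all_order all_algebra.
From mathcomp Require Import all_classical all_reals all_analysis.

Set Implicit Arguments.
Unset Strict Implicit.
Unset Printing Implicit Defensive.

Import Order.TTheory GRing.Theory Num.Theory.
Import numFieldNormedType.Exports.

Local Open Scope classical_set_scope.
Local Open Scope ring_scope.

(** The exponential is forced by its points: an element of [g ^ f] over [z]
must be a morphism between the fibres at [z], and a plot [F] of [g ^ f] must be
what makes [u |-> F (h u) (q u)] a plot of [Y] whenever [q] is a plot of [X]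
lying over [varpi \o F \o h].  With this definition, currying is almost
formal.  Evaluation is a morphism because the condition on [F] may be tested at
[h = id]; the transpose [w |-> k (w, -)] of [k : W x_Z X -> Y] is a morphism
because, for a plot [p] of [W], the pair [(p \o h, q)] is a plot of the fibre
product, which [k] sends to a plot of [Y].

The part that is not formal is that the maps [F] satisfying the condition are
stable under reindexing, and this holds because the maps of the site compose
([site_hom_comp]).  That in turn is analysis.  For fixed [w], the map
[t |-> g (g' (t, w), Phi' w)] is a composite of smooth maps, so the chain rule
is needed at every order ([Ck_comp]).  For fixed [t], the point
[a w = g' (t, w)] at which [g] is evaluated varies with [w], and measurability
in [w] follows from continuity of [g] in its first variable together with
separability of R^m, in the manner of Caratheodory functions
([measurable_caratheodory_comp]).

The universal property of an exponential quantifies over all product cones on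
[W] and [A], but it is enough to verify it on one of them
([is_exponential_chosen]), here the fibre product.  Local cartesian closedness
follows, since every object of the slice over [Z] is a morphism to [Z]. *)

(** * Composition of maps of class C^k *)

(** Leibniz rule for the bilinear map given by scaling. *)
Lemma is_diff_scale (R : realType) (V W : normedModType R)
    (a da : V -> R) (b db : V -> W) (x : V) :
  is_diff x a da -> is_diff x b db ->
  is_diff x (fun y => a y *: b y) (fun v => a x *: db v + da v *: b x).
Proof.
move=> dax dbx.
have scale_bilinear : bilinear_for
    (GRing.Scale.Law.clone _ _ *:%R _) (GRing.Scale.Law.clone _ _ *:%R _)
    (@GRing.scale R W).
  split=> [u|u] c y z /=; first by rewrite scalerDl scalerA.
  by rewrite scalerDr !scalerA mulrC.
pose scaleM := bilinear_isBilinear.Build R R W W _ _ _ scale_bilinear.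
pose scaleB : {bilinear R -> W -> W} := HB.pack (@GRing.scale R W) scaleM.
have scale_cont : continuous (fun p : R * W => scaleB p.1 p.2).
  by move=> p; exact: scale_continuous.
have scale_diff (p : R * W) :
    is_diff p (fun q => q.1 *: q.2) (fun q => p.1 *: q.2 + q.1 *: p.2).
  apply: DiffDef; first exact: (differentiable_bilin p scale_cont).
  exact: (diff_bilin p scale_cont).
exact: (is_diff_comp (is_diff_pair dax dbx) (scale_diff (a x, b x))).
Qed.

Lemma is_diff_coord (R : realType) (V : normedModType R) (n : nat)
    (f df : V -> 'rV[R]_n) (x : V) (i : 'I_n) :
  is_diff x f df -> is_diff x (fun y => f y 0 i) (fun v => df v 0 i).
Proof.
move=> dfx.
have coord_linear : linear (fun N : 'rV[R]_n => N 0 i).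
  by move=> c u v; rewrite !mxE.
pose coordM := GRing.isLinear.Build _ _ _ _ _ coord_linear.
pose coordL : {linear 'rV[R]_n -> R} :=
  HB.pack (fun N : 'rV[R]_n => N 0 i) coordM.
have coord_cont : continuous coordL by exact: coord_continuous.
have coord_diff : is_diff (f x) (fun N : 'rV[R]_n => N 0 i) (fun N => N 0 i).
  by apply: DiffDef; [exact: linear_differentiable coord_cont
                     |exact: diff_lin coord_cont].
exact: is_diff_comp dfx coord_diff.
Qed.

Lemma Ck_pred (R : realType) m n k (f : 'rV[R]_m -> 'rV[R]_n) :
  Ck k.+1 f -> Ck k f.
Proof.
elim: k f => [|k IHk] f [df Cdf]; last by split=> // v; exact: IHk (Cdf v).
by move=> x; exact: differentiable_continuous (df x).
Qed.

Lemma Ck_cst (R : realType) m n k (a : 'rV[R]_n) :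
  Ck k (fun _ : 'rV[R]_m => a).
Proof.
elim: k a => [|k IHk] a; first exact: cst_continuous.
split=> [x|v]; first exact: differentiable_cst.
have -> : (fun x => 'd (fun=> a) x v) = fun=> 0.
  by apply/funext => x; rewrite (diff_cst a).
exact: IHk.
Qed.

Lemma Ck_id (R : realType) n k : Ck k (fun x : 'rV[R]_n => x).
Proof.
case: k => [|k]; first by move=> x; exact: (@cvg_id _ (nbhs x)).
have id_diff (x : 'rV[R]_n) : is_diff x (fun y => y) id by exact: is_diff_id.
split=> [x|v]; first exact: ex_diff.
have -> : (fun x : 'rV[R]_n => 'd (fun y => y) x v) = fun=> v.
  by apply/funext => x; rewrite diff_val.
exact: Ck_cst.
Qed.

Lemma Ck_add (R : realType) m n k (f g : 'rV[R]_m -> 'rV[R]_n) :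
  Ck k f -> Ck k g -> Ck k (fun x => f x + g x).
Proof.
elim: k f g => [|k IHk] f g Cf Cg; first by move=> x; exact: cvgD (Cf x) (Cg x).
case: Cf Cg => [df Cdf] [dg Cdg]; split=> [x|v]; first exact: differentiableD.
have -> : (fun x => 'd (fun y => f y + g y) x v) = fun x => 'd f x v + 'd g x v.
  by apply/funext => x; exact: (congr1 (@^~ v) (diffD (df x) (dg x))).
exact: (IHk _ _ (Cdf v) (Cdg v)).
Qed.

Lemma Ck_sum (R : realType) m n k (I : finType)
    (f : I -> 'rV[R]_m -> 'rV[R]_n) :
  (forall i, Ck k (f i)) -> Ck k (fun x => \sum_i f i x).
Proof.
move=> Cf; elim: (index_enum I) => [|i s IHs].
  by under eq_fun do rewrite big_nil; exact: Ck_cst.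
by under eq_fun do rewrite big_cons; exact: Ck_add.
Qed.

(** The scalar factor is given as a coordinate of a vector-valued map because
[Ck] speaks of row vectors only.  In this form the derivative is again a sum of
such products, so the class is stable under the induction on [k]. *)
Lemma Ck_coord_scale (R : realType) m n p k
    (a : 'rV[R]_m -> 'rV[R]_p) (b : 'rV[R]_m -> 'rV[R]_n) (i : 'I_p) :
  Ck k a -> Ck k b -> Ck k (fun x => a x 0 i *: b x).
Proof.
elim: k a b => [|k IHk] a b Ca Cb.
  move=> x; apply: cvgZ (Cb x).
  exact: (continuous_comp (Ca x) (@coord_continuous _ _ _ _ _ _)).
have [da Cda] := Ca; have [db Cdb] := Cb.
have abdiff x : is_diff x (fun y => a y 0 i *: b y)
    (fun v => a x 0 i *: 'd b x v + 'd a x v 0 i *: b x).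
  apply: (is_diff_scale (a := fun y => a y 0 i) (da := fun v => 'd a x v 0 i)).
    exact/is_diff_coord/differentiableP.
  exact: differentiableP.
split=> [x|v]; first exact: ex_diff.
under eq_fun do rewrite diff_val.
apply: Ck_add; apply: IHk.
- exact: Ck_pred.
- exact: Cdb.
- exact: Cda.
- exact: Ck_pred.
Qed.

(** The derivative [x |-> 'd f (g x) ('d g x v)] is not a composite of maps of
class C^k, since its direction moves with [x].  Decomposing that direction in
the standard basis makes it a sum of products of coordinates of [x |-> 'd g x v]
with composites of [y |-> 'd f y 'e_i] and [g], to which the induction
hypothesis applies. *)
Lemma Ck_comp (R : realType) m n p k
    (f : 'rV[R]_n -> 'rV[R]_p) (g : 'rV[R]_m -> 'rV[R]_n) :
  Ck k f -> Ck k g -> Ck k (f \o g).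
Proof.
elim: k f g => [|k IHk] f g Cf Cg.
  by move=> x; exact: continuous_comp (Cg x) (Cf (g x)).
have [df Cdf] := Cf; have [dg Cdg] := Cg.
split=> [x|v]; first exact: differentiable_comp.
have -> : (fun x => 'd (f \o g) x v) =
    fun x => \sum_i 'd g x v 0 i *: ((fun y => 'd f y 'e_i) \o g) x.
  apply/funext => x; rewrite diff_comp//= {1}(row_sum_delta ('d g x v)).
  by rewrite linear_sum; apply: eq_bigr => i _; rewrite linearZ.
apply: Ck_sum => i; apply: Ck_coord_scale; first exact: Cdg.
exact: (IHk (fun y => 'd f y 'e_i) g (Cdf 'e_i) (Ck_pred Cg)).
Qed.

Lemma smooth_comp (R : realType) m n p
    (f : 'rV[R]_n -> 'rV[R]_p) (g : 'rV[R]_m -> 'rV[R]_n) :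
  smooth f -> smooth g -> smooth (f \o g).
Proof. by move=> sf sg k; exact: Ck_comp. Qed.

(** * Measurability of Caratheodory composites *)

Lemma dense_rat_rV (R : realType) n (x : 'rV[R]_n) (e : R) : 0 < e ->
  exists q : 'rV[rat]_n, ball x e (map_mx ratr q).
Proof.
move=> e0.
have /choice[q xq] (i : 'I_n) : exists q : rat, ball (x 0 i) e (ratr q : R).
  have /rat_in_itvoo[q] : x 0 i < x 0 i + e by rewrite ltrDl.
  rewrite in_itv/= => /andP[xq qxe]; exists q.
  by rewrite -ball_normE/= distrC gtr0_norm ?subr_gt0// ltrBlDl.
exists (\row_i q i); split=> // i j; rewrite !mxE ord1; exact: xq.
Qed.

(** For [U] open, [g (a w) w] belongs to [U] iff, for some precision [r], every
rational vector [q] closer than [r] to [a w] is such that a neighbourhood of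
[g q w] consists of points whose ball of radius [r] lies in [U]: continuity
gives the existence of [r], and conversely it provides a [q] with [g (a w) w]
in the ball of radius [r] around [g q w].  This uses [g] at countably many
points [q] only, hence countably many measurable conditions on [w]. *)
Lemma measurable_caratheodory_comp (R : realType) d (T : measurableType d) m n
    (g : 'rV[R]_m -> T -> 'rV[R]_n) (a : T -> 'rV[R]_m) :
  (forall w, continuous (g ^~ w)) ->
  (forall t, measurable_fun setT (g t : T -> borel_rV R n)) ->
  measurable_fun setT (a : T -> borel_rV R m) ->
  measurable_fun setT ((fun w => g (a w) w) : T -> borel_rV R n).
Proof.
move=> cg mg ma.
have preim_open k (f : T -> 'rV[R]_k) (V : set 'rV[R]_k) :
    measurable_fun setT (f : T -> borel_rV R k) -> open V ->
    measurable (f @^-1` V).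
  move=> mf oV; rewrite -[X in measurable X]setTI.
  by apply: mf => //; exact: sub_sigma_algebra.
apply: (@measurability _ _ _ (borel_rV R n) _ _ (@open 'rV[R]_n)) => //.
move=> _ [U oU <-]; rewrite setTI.
pose r i : R := i.+1%:R^-1.
pose V i : set 'rV[R]_n := [set y | ball y (r i) `<=` U]^°.
(* Taking the interior in [V] makes it open; half of the radius of a ball around
   [g (a w) w] inside [U] is spent on the distance to [g q w], half on [r]. *)
have -> : (fun w => g (a w) w) @^-1` U = \bigcup_i \bigcap_(q : 'rV[rat]_m)
    (~` (a @^-1` ball (map_mx ratr q : 'rV[R]_m) (r i))
     `|` g (map_mx ratr q) @^-1` V i).
  apply/seteqP; split => w /=.
    move=> Uw; have /nbhs_ballP[e /= e0 eU] : nbhs (g (a w) w) U.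
      exact: open_nbhs_nbhs.
    have e20 : 0 < e / 2 by rewrite divr_gt0.
    have /nbhs_ballP[d0 /= d00 dg] := cg w (a w) _ (nbhsx_ballx _ _ e20).
    have md : 0 < Num.min d0 (e / 2) by rewrite lt_min d00.
    have [i ri] : exists i, r i < Num.min d0 (e / 2).
      have [i _ ri] := near_infty_natSinv_lt (PosNum md).
      by exists i; exact: (ri i (leqnn i)).
    move: ri; rewrite lt_min => /andP[rd re].
    exists i => // q _; rewrite /setU/=.
    have [aq|] := pselect (ball (map_mx ratr q : 'rV[R]_m) (r i) (a w));
      last by left.
    have gq : ball (g (a w) w) (e / 2) (g (map_mx ratr q) w).
      by apply: dg; exact/(le_ball (ltW rd))/ball_sym.
    right; apply: filterS (open_nbhs_nbhs (conj (ball_open _ _) gq)).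
    move=> y gy z yz; apply: eU; rewrite (splitr e); apply: ball_triangle gy _.
    exact: le_ball (ltW re) _ yz.
  move=> [i _ iw].
  have ri0 : 0 < r i by rewrite invr_gt0 ltr0n.
  have /nbhs_ballP[d0 /= d00 dg] := cg w (a w) _ (nbhsx_ballx _ _ ri0).
  have md : 0 < Num.min d0 (r i) by rewrite lt_min d00.
  have [q aq] := dense_rat_rV (a w) md.
  have gq : ball (g (a w) w) (r i) (g (map_mx ratr q) w).
    by apply: dg; apply: le_ball aq; rewrite ge_min lexx.
  case: (iw q I) => [/=|/interior_subset]; last by apply; exact: ball_sym.
  by case; apply/ball_sym; apply: le_ball aq; rewrite ge_min lexx orbT.
apply: bigcupT_measurable => i.
rewrite -[X in measurable X]setCK setC_bigcap; apply: measurableC.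
apply: countable_bigcupT_measurable => // q; apply/measurableC/measurableU.
  by apply/measurableC/preim_open => //; exact: ball_open.
by apply: preim_open => //; exact: open_interior.
Qed.

(** * The site is a category *)

Lemma site_hom_id (R : realType) n : site_hom (fun u : Omega_ R n => u).
Proof.
exists fst, id; split; last by [].
  by split=> [w k|t]; [exact: Ck_id|exact: measurable_cst].
exact: measurable_id.
Qed.

Lemma site_hom_comp (R : realType) m n p
    (h : Omega_ R n -> Omega_ R p) (h' : Omega_ R m -> Omega_ R n) :
  site_hom h -> site_hom h' -> site_hom (h \o h').
Proof.
move=> [g [Phi [[sg mg] mPhi hE]]] [g' [Phi' [[sg' mg'] mPhi' hE']]].
exists (fun u => g (g' u, Phi' u.2)), (Phi \o Phi'); split; last 1 first.
- by move=> t w; rewrite /= hE' hE.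
- split=> [w|t]; first exact: (smooth_comp (sg (Phi' w)) (sg' w)).
  apply: (measurable_caratheodory_comp (g := fun s w => g (s, Phi' w))) (mg' t).
    by move=> w; exact: sg (Phi' w) 0%N.
  by move=> s; exact: measurableT_comp (mg s) mPhi'.
- exact: measurableT_comp mPhi mPhi'.
Qed.

(** * Exponentials tested on a chosen product *)

Lemma is_product_inverse (C : category) (A B P Q : C)
    (p1 : mor P A) (p2 : mor P B) (q1 : mor Q A) (q2 : mor Q B) :
  is_product p1 p2 -> is_product q1 q2 ->
  exists (i : mor Q P) (j : mor P Q),
    [/\ mor_comp p1 i = q1, mor_comp p2 i = q2,
        mor_comp q1 j = p1, mor_comp q2 j = p2 & mor_comp j i = mor_id Q].
Proof.
move=> prodP prodQ.
have [i [[pi1 pi2] _]] := prodP Q q1 q2.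
have [j [[qj1 qj2] _]] := prodQ P p1 p2.
exists i, j; split=> //.
have [k [_ uniqk]] := prodQ Q q1 q2.
transitivity k; first by symmetry; apply: uniqk; rewrite !mor_compA qj1 qj2.
by apply: uniqk; rewrite !mor_compm1.
Qed.

(** Any other product cone is isomorphic to the chosen one, and precomposition
with the isomorphism identifies the two currying problems. *)
Lemma is_exponential_chosen (C : category) (A B E P : C)
    (p1 : mor P E) (p2 : mor P A) (ev : mor P B) :
  is_product p1 p2 ->
  (forall W : C, exists (Q : C) (q1 : mor Q W) (q2 : mor Q A),
    is_product q1 q2 /\
    forall k : mor Q B, exists! l : mor W E, exists u : mor Q P,
      [/\ mor_comp p1 u = mor_comp l q1, mor_comp p2 u = q2
        & mor_comp ev u = k]) ->
  is_exponential p1 p2 ev.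
Proof.
move=> prodP transpose; split=> // W Q' q1' q2' prodQ' k'.
have [Q [q1 [q2 [prodQ curry]]]] := transpose W.
have [i [j [qi1 qi2 qj1 qj2 ji]]] := is_product_inverse prodQ prodQ'.
have [l [[u [pu1 pu2 evu]] uniql]] := curry (mor_comp k' j).
exists l; split.
  exists (mor_comp u i); split.
  - by rewrite mor_compA pu1 -mor_compA qi1.
  - by rewrite mor_compA pu2 qi2.
  - by rewrite mor_compA evu -mor_compA ji mor_compm1.
move=> l' [u' [pu1' pu2' evu']]; apply: uniql; exists (mor_comp u' j); split.
- by rewrite mor_compA pu1' -mor_compA qj1.
- by rewrite mor_compA pu2' qj2.
- by rewrite mor_compA evu'.
Qed.

(** * Products in the slice *)

Lemma sval_inj (T : Type) (P : T -> Prop) : injective (@proj1_sig T P).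
Proof. by move=> [x px] [y py] /= xy; exact: eq_exist. Qed.

Lemma fibre_product_is_product (R : realType) (X Y Z : SSS R)
    (f : sss_hom X Z) (g : sss_hom Y Z) :
  is_product (fibre_fst_over f g) (fibre_snd_over f g).
Proof.
move=> [W t] [a fa] [b gb].
have ab w : f (a w) = g (b w).
  have /(congr1 (fun h : sss_hom W Z => h w)) /= -> := fa.
  by have /(congr1 (fun h : sss_hom W Z => h w)) /= -> := gb.
have ab_smooth : @sample_smooth R W (fibre_product f g)
    (fun w => exist _ (a w, b w) (ab w)).
  by move=> n p Wp; split; [exact: (hom_smooth a Wp)|exact: (hom_smooth b Wp)].
have over : sss_comp (sss_comp f (fibre_fst f g)) (MkHom ab_smooth) = t.
  by rewrite -[RHS]fa; exact: sss_hom_eq.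
exists (exist _ (MkHom ab_smooth : @mor (SSS_cat R) _ _) over); split.
  by split; apply: slice_hom_eq; exact: sss_hom_eq.
move=> [v ev] [/(congr1 sval) /= va /(congr1 sval) /= vb].
apply: slice_hom_eq; apply: sss_hom_eq => w /=; apply: sval_inj => /=.
rewrite -va -vb; exact: esym (surjective_pairing _).
Qed.

(** * The exponential of fibrewise maps *)

Section fibrewise_maps.
Variables (R : realType) (X Y Z : SSS R) (f : sss_hom X Z) (g : sss_hom Y Z).

Lemma fibrewise_apply_over (F : fibrewise_map f g) (x : X)
    (e : f x = varpi f g F) :
  g (fibrewise_apply e) = varpi f g F.
Proof. exact: svalP (projT2 F (exist _ x e)). Qed.

(** The proof [e] depends on [F] and [x], so neither can be rewritten inside
[fibrewise_apply e]; this congruence moves both at once. *)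
Lemma fibrewise_apply_eq (F G : fibrewise_map f g) (x y : X)
    (e : f x = varpi f g F) (e' : f y = varpi f g G) :
  F = G -> x = y -> fibrewise_apply e = fibrewise_apply e'.
Proof. by move=> FG xy; subst; rewrite (Prop_irrelevance e e'). Qed.

(** The morphisms in [F] and [G] have different types when the base points are
only propositionally equal.  Comparing them through [fibrewise_apply] avoids any
transport. *)
Lemma fibrewise_map_ext (F G : fibrewise_map f g) :
  varpi f g F = varpi f g G ->
  (forall x (e : f x = varpi f g F) (e' : f x = varpi f g G),
    fibrewise_apply e = fibrewise_apply e') ->
  F = G.
Proof.
case: F G => [z phi] [z' psi] /= zz'; subst z' => phi_psi; congr existT.
apply: sss_hom_eq => -[x e]; apply: sval_inj; exact: phi_psi.
Qed.

(** Stability under reindexing along [h] tests [F \o h] at [h'], that is [F] at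
[h \o h'], which must be a map of the site. *)
Lemma fibrewise_plotP : sss_axioms (fibrewise_plot f g).
Proof.
split=> [n [z phi]|m n F h [ZF FY] hh].
  split=> [|m h hh q Xq e]; first exact: (plot_cst (plotP Z)).
  have phi_q := hom_smooth phi (p := fun u => exist _ (q u) (e u)).
  exact: phi_q Xq.
split=> [|k h' hh' q Xq e]; first exact: (plot_comp (plotP Z) ZF hh).
exact: (FY k (h \o h') (site_hom_comp hh hh') q Xq e).
Qed.

Definition fibrewise_space : SSS R := MkSSS fibrewise_plotP.

Lemma varpi_smooth : @sample_smooth R fibrewise_space Z (varpi f g).
Proof. by move=> n p []. Qed.

Definition varpi_hom : sss_hom fibrewise_space Z := MkHom varpi_smooth.

Definition fibrewise_eval (w : fibre_product varpi_hom f) : Y :=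
  fibrewise_apply (esym (proj2_sig w)).

Lemma fibrewise_eval_smooth : sample_smooth fibrewise_eval.
Proof.
move=> n p [[_ pY] pX]; exact: (pY n id (@site_hom_id R n) _ pX).
Qed.

Lemma fibrewise_eval_over :
  sss_comp g (MkHom fibrewise_eval_smooth) =
  sss_comp varpi_hom (fibre_fst varpi_hom f).
Proof. by apply: sss_hom_eq => w; exact: fibrewise_apply_over. Qed.

Definition fibrewise_eval_hom :
    mor (fibre_product_over varpi_hom f) (sss_over g) :=
  exist _ (MkHom fibrewise_eval_smooth : @mor (SSS_cat R) _ _)
    fibrewise_eval_over.

Section transpose.
Variables (W : SSS R) (t : sss_hom W Z) (k : sss_hom (fibre_product t f) Y).
Hypothesis k_over : forall w, g (k w) = t (sval w).1.

Definition transpose_at (w : W) (x : fibre f (t w)) : fibre g (t w) :=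
  exist _ (k (exist _ (w, sval x) (esym (proj2_sig x)))) (k_over _).

Lemma transpose_at_smooth (w : W) : sample_smooth (@transpose_at w).
Proof.
move=> n p Xp; apply: (hom_smooth k (p := fun u => exist _ (w, sval (p u)) _)).
by split; [exact: (plot_cst (plotP W))|exact: Xp].
Qed.

Definition transpose (w : W) : fibrewise_space :=
  existT _ (t w) (MkHom (@transpose_at_smooth w)).

Lemma transpose_smooth : sample_smooth transpose.
Proof.
move=> n p Wp; split=> [|m h hh q Xq e]; first exact: (hom_smooth t Wp).
apply: (hom_smooth k (p := fun u => exist _ (p (h u), q u) (esym (e u)))).
by split; [exact: (plot_comp (plotP W) Wp hh)|exact: Xq].
Qed.

End transpose.


(** Existence and uniqueness of the transpose both rest on this: whatever map
[u] plays the role of [l x id], evaluation after [u] is application of [l]. *)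
Lemma fibrewise_eval_factor (W : SSS R) (t : sss_hom W Z)
    (l : mor (sss_over t) (sss_over varpi_hom))
    (u : mor (fibre_product_over t f) (fibre_product_over varpi_hom f)) :
  mor_comp (fibre_fst_over varpi_hom f) u = mor_comp l (fibre_fst_over t f) ->
  mor_comp (fibre_snd_over varpi_hom f) u = fibre_snd_over t f ->
  forall (w : fibre_product t f)
    (e : f (sval w).2 = varpi f g (slice_fun l (sval w).1)),
  fibrewise_eval (slice_fun u w) = fibrewise_apply e.
Proof.
move=> /(congr1 sval) u1 /(congr1 sval) u2 w e; apply: fibrewise_apply_eq.
  exact: (congr1
    (fun h : sss_hom (fibre_product t f) fibrewise_space => h w) u1).
exact: (congr1 (fun h : sss_hom (fibre_product t f) X => h w) u2).
Qed.

Lemma fibrewise_is_exponential :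
  is_exponential (fibre_fst_over varpi_hom f) (fibre_snd_over varpi_hom f)
    fibrewise_eval_hom.
Proof.
apply: is_exponential_chosen; first exact: fibre_product_is_product.
move=> [W t]; exists (fibre_product_over t f).
exists (fibre_fst_over t f), (fibre_snd_over t f).
split; first exact: fibre_product_is_product.
move=> [k k_over].
have kE w : g (k w) = t (sval w).1.
  exact: (congr1 (fun h : sss_hom (fibre_product t f) Z => h w) k_over).
have l_over : sss_comp varpi_hom (MkHom (transpose_smooth kE)) = t.
  exact: sss_hom_eq.
pose l : mor (sss_over t) (sss_over varpi_hom) :=
  exist _ (MkHom (transpose_smooth kE) : @mor (SSS_cat R) _ _) l_over.
exists l; split.
  have [u [[u1 u2] _]] := fibre_product_is_product
    (mor_comp l (fibre_fst_over t f)) (fibre_snd_over t f).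
  exists u; split=> //; apply: slice_hom_eq; apply: sss_hom_eq => w.
  have e : f (sval w).2 = varpi f g (slice_fun l (sval w).1).
    exact: esym (proj2_sig w).
  rewrite -[LHS]/(fibrewise_eval (slice_fun u w)).
  rewrite (fibrewise_eval_factor u1 u2 e).
  by congr (hom_fun k _); apply: sval_inj => /=; case: (sval w).
move=> l' [u [u1 u2 evu]]; apply: slice_hom_eq; apply: sss_hom_eq => w.
have l'_over : varpi f g (slice_fun l' w) = t w.
  exact: (congr1 (fun h : sss_hom W Z => h w) (svalP l')).
apply: fibrewise_map_ext; first exact: esym l'_over.
move=> x e e'.
rewrite -(fibrewise_eval_factor u1 u2 (w := exist _ (w, x) (esym e)) e').
exact: esym (congr1 (fun h : mor (fibre_product_over t f) (sss_over g) =>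
  slice_fun h (exist _ (w, x) (esym e))) evu).
Qed.
End fibrewise_maps.

(** * Local cartesian closedness *)

Lemma SSS_has_terminal (R : realType) : has_terminal (SSS_cat R).
Proof.
have ax : sss_axioms (fun n => [set: Omega_ R n -> unit]) by [].
exists (MkSSS ax) => W.
have cst_smooth : @sample_smooth R W (MkSSS ax) (fun=> tt) by [].
by exists (MkHom cst_smooth); split=> // v _; apply: sss_hom_eq => w;
  case: (v w).
Qed.

Lemma slice_has_terminal (C : category) (Z : C) : has_terminal (slice Z).
Proof.
exists (SliceObj (mor_id Z)) => -[W t].
exists (exist (fun u => mor_comp (mor_id Z) u = t) t (mor_comp1m t)).
split=> // -[v ev] _; apply: slice_hom_eq.
by rewrite /= -[RHS]mor_comp1m; exact: esym ev.
Qed.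

Theorem proposition4p24 (R : realType) :
  (forall (X Y Z : SSS R) (f : sss_hom X Z) (g : sss_hom Y Z),
    exists (ax : sss_axioms (fibrewise_plot f g))
           (varpi_smooth : @sample_smooth R (MkSSS ax) Z (varpi f g)),
      let pi : sss_hom (MkSSS ax) Z := MkHom varpi_smooth in
      exists ev : mor (fibre_product_over pi f) (sss_over g),
        (forall w : fibre_product pi f,
           slice_fun ev w = fibrewise_apply (esym (proj2_sig w))) /\
        is_exponential (fibre_fst_over pi f) (fibre_snd_over pi f) ev) /\
  locally_cartesian_closed (SSS_cat R).
Proof.
split=> [X Y Z f g|].
  exists (fibrewise_plotP f g), (@varpi_smooth R X Y Z f g).
  exists (fibrewise_eval_hom f g); split=> //.
  exact: fibrewise_is_exponential.
split=> [|Z]; first exact: SSS_has_terminal.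
split=> [|[X f] [Y g]|[X f] [Y g]]; first exact: slice_has_terminal.
  exists (fibre_product_over f g), (fibre_fst_over f g), (fibre_snd_over f g).
  exact: fibre_product_is_product.
exists (sss_over (varpi_hom f g)), (fibre_product_over (varpi_hom f g) f).
exists (fibre_fst_over _ _), (fibre_snd_over _ _), (fibrewise_eval_hom f g).
exact: fibrewise_is_exponential.
Qed.
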